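(* Let $\Sigma$ be a finite alphabet, let $f, g:\Sigma^*\to[0,1]$ be functions computed by affine finite automata over $\Sigma$, and let $\alpha,\beta\ge 0$ be real numbers with $\alpha+\beta=1$. Then there exists an affine finite automaton $\mathcal{C}$ over $\Sigma$ such that $f_{\mathcal{C}}(w) = \alpha f(w)+\beta g(w)$ for all $w\in\Sigma^*$.
   Context: A real vector is affine if its coordinates sum to $1$; a real square matrix is affine if each of its columns is an affine vector. An affine finite automaton (AfA) over a finite alphabet $\Sigma$ is a tuple $A = (E, \Sigma, \{M_x\}_{x\in\Sigma}, \vec{v}_0, E_a)$, where $E=\{e_1,\dots,e_k\}$ is a finite set of states, each $M_x$ is a $k\times k$ real affine matrix, $\vec{v}_0\in\mathbb{R}^k$ is an affine vector (the initial state), and $E_a\subseteq E$ is the set of accepting states. For $w = w_1\cdots w_n\in\Sigma^*$ put $M_w = M_{w_n}\cdots M_{w_1}$ (the identity if $w$ is the empty word) and $\vec{v}_f = M_w\vec{v}_0$. The function $f_A:\Sigma^*\to[0,1]$ computed by $A$ is $$f_A(w) = \frac{\sum_{e_i\in E_a} |(\vec{v}_f)_i|}{\sum_{e_i\in E} |(\vec{v}_f)_i|}.$$ *)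

(* Defs.v *)
From HB Require Import structures.
From mathcomp Require Import all_boot all_order all_algebra.
From mathcomp Require Import reals.

Set Implicit Arguments.
Unset Strict Implicit.
Unset Printing Implicit Defensive.

Import Order.TTheory GRing.Theory Num.Theory.
Local Open Scope ring_scope.

Definition affine_vec (R : realType) (k : nat) (v : 'cV[R]_k) : Prop :=
  \sum_(i < k) v i 0 = 1.

Definition affine_mx (R : realType) (k : nat) (M : 'M[R]_k) : Prop :=
  forall j : 'I_k, affine_vec (col j M).

(* The state set {e_1, ..., e_k} is 'I_k; k > 0 is forced by afa_init_affine. *)
Record afa (R : realType) (Sigma : finType) : Type := AfA {
  afa_size : nat;
  afa_trans : Sigma -> 'M[R]_afa_size;
  afa_init : 'cV[R]_afa_size;
  afa_acc : {set 'I_afa_size};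
  afa_trans_affine : forall x : Sigma, affine_mx (afa_trans x);
  afa_init_affine : affine_vec afa_init
}.

(* M_w = M_{w_n} ... M_{w_1}: the first letter is the rightmost factor. *)
Definition afa_word_mx (R : realType) (Sigma : finType) (A : afa R Sigma)
    (w : seq Sigma) : 'M[R]_(afa_size A) :=
  foldl (fun P x => afa_trans A x *m P) 1%:M w.

Definition afa_final (R : realType) (Sigma : finType) (A : afa R Sigma)
    (w : seq Sigma) : 'cV[R]_(afa_size A) :=
  afa_word_mx A w *m afa_init A.

Definition afa_fun (R : realType) (Sigma : finType) (A : afa R Sigma)
    (w : seq Sigma) : R :=
  (\sum_(i in afa_acc A) `|afa_final A w i 0|) /
  (\sum_(i < afa_size A) `|afa_final A w i 0|).

Definition computed_by_afa (R : realType) (Sigma : finType)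
    (f : seq Sigma -> R) : Prop :=
  exists A : afa R Sigma, forall w : seq Sigma, f w = afa_fun A w.

Lemma affine_mulmx (R : realType) (k : nat) (M : 'M[R]_k) (v : 'cV[R]_k) :
  affine_mx M -> affine_vec v -> affine_vec (M *m v).
Proof.
move=> hM hv; rewrite /affine_vec -[RHS]hv.
under eq_bigr do rewrite mxE.
rewrite exchange_big /=; apply: eq_bigr => j _.
rewrite -mulr_suml -[RHS]mul1r; congr (_ * _).
by rewrite -[RHS](hM j); apply: eq_bigr => i _; rewrite mxE.
Qed.

Lemma afa_final_affine (R : realType) (Sigma : finType) (A : afa R Sigma)
    (w : seq Sigma) : affine_vec (afa_final A w).
Proof.
elim/last_ind: w => [|w x IHw].
  by rewrite /afa_final /afa_word_mx /= mul1mx; exact: afa_init_affine.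
rewrite /afa_final /afa_word_mx foldl_rcons -mulmxA.
by apply: affine_mulmx IHw; exact: afa_trans_affine.
Qed.

(* The denominator of afa_fun never vanishes, so its division is genuine. *)
Lemma afa_norm_gt0 (R : realType) (Sigma : finType) (A : afa R Sigma)
    (w : seq Sigma) : 0 < \sum_(i < afa_size A) `|afa_final A w i 0|.
Proof.
apply: lt_le_trans (ler_norm_sum _ _ _).
by rewrite (afa_final_affine A w) normr1.
Qed.

Lemma afa_fun_01 (R : realType) (Sigma : finType) (A : afa R Sigma)
    (w : seq Sigma) : 0 <= afa_fun A w <= 1.
Proof.
have pos := afa_norm_gt0 A w.
rewrite /afa_fun divr_ge0 ?sumr_ge0 //= ler_pdivrMr // mul1r.
by rewrite [leRHS](bigID (mem (afa_acc A))) /= lerDl sumr_ge0.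
Qed.

(* Main.v *)
Require Import Defs.
From HB Require Import structures.
From mathcomp Require Import all_boot all_order all_algebra.
From mathcomp Require Import reals.

Set Implicit Arguments.
Unset Strict Implicit.
Unset Printing Implicit Defensive.

Import Order.TTheory GRing.Theory Num.Theory.
Local Open Scope ring_scope.

(* If A and B reach the vectors u and v on w, then the direct sum of
   alpha (u (x) v) and beta (u (x) v) is an affine vector of l1-norm |u| |v|,
   and it evolves linearly, under two copies of the tensor product of the
   transition matrices.  Reading acceptance off A's coordinate in the first copy
   and off B's coordinate in the second gives the accepting weight
   alpha |u|_acc |v| + beta |u| |v|_acc, so the quotient is alpha f + beta g. *)

Lemma afa_final_rcons (R : realType) (Sigma : finType) (A : afa R Sigma)
    (w : seq Sigma) (x : Sigma) :
  afa_final A (rcons w x) = afa_trans A x *m afa_final A w.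
Proof. by rewrite /afa_final /afa_word_mx foldl_rcons mulmxA. Qed.

(** Automata have ordinals as states, so matrices and vectors indexed by a finite type [S] are
    transported along [enum_val]. Taking the whole trajectory [v] as data means that only its
    one-letter recurrence has to be checked, by induction on the word from the right. *)
Lemma afa_of_finType (R : realType) (Sigma S : finType)
    (M : Sigma -> S -> S -> R) (v : seq Sigma -> S -> R) (acc : {set S})
    (M_affine : forall x t, \sum_s M x s t = 1)
    (v_affine : \sum_s v [::] s = 1)
    (v_rcons : forall w x s, v (rcons w x) s = \sum_t M x s t * v w t) :
  exists C : afa R Sigma, forall w,
    afa_fun C w = (\sum_(s in acc) `|v w s|) / (\sum_s `|v w s|).
Proof.
pose N x : 'M[R]_#|S| := \matrix_(i, j) M x (enum_val i) (enum_val j).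
pose v0 : 'cV[R]_#|S| := \col_i v [::] (enum_val i).
have sumE (F : S -> R) : \sum_(i < #|S|) F (enum_val i) = \sum_s F s.
  by rewrite [RHS](reindex _ (onW_bij _ (enum_val_bij S))).
have N_affine x : affine_mx (N x).
  move=> j; rewrite /affine_vec -(M_affine x (enum_val j)) -sumE.
  by apply: eq_bigr => i _; rewrite !mxE.
have v0_affine : affine_vec v0.
  by rewrite /affine_vec -v_affine -sumE; apply: eq_bigr => i _; rewrite mxE.
pose C := AfA [set i | enum_val i \in acc] N_affine v0_affine.
have finalE w i : afa_final C w i 0 = v w (enum_val i).
  elim/last_ind: w i => [|w x IHw] i.
    by rewrite /afa_final /afa_word_mx /= mul1mx mxE.
  rewrite afa_final_rcons mxE v_rcons -sumE.
  by apply: eq_bigr => j _; rewrite IHw mxE.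
exists C => w; rewrite /afa_fun -(sumE (fun s => `|v w s|)).
congr (_ / _); last by apply: eq_bigr => i _; rewrite finalE.
rewrite [RHS](reindex _ (onW_bij _ (enum_val_bij S))) /=.
by apply: eq_big => [i|i _]; rewrite ?inE ?finalE.
Qed.

(** Distributivity inside each copy [b], where the index set is a rectangle. The rectangle may vary
    with [b], as the accepting set requires. *)
Lemma sum_bool_tensor (R : comPzRingType) (I J : finType)
    (P : bool -> pred I) (Q : bool -> pred J)
    (c : bool -> R) (a : bool -> I -> R) (d : bool -> J -> R) :
  \sum_(s : bool * (I * J) | P s.1 s.2.1 && Q s.1 s.2.2)
     c s.1 * (a s.1 s.2.1 * d s.1 s.2.2) =
  \sum_b c b * ((\sum_(i | P b i) a b i) * (\sum_(j | Q b j) d b j)).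
Proof.
under [RHS]eq_bigr => b _ do rewrite big_distrlr pair_big /= mulr_sumr.
by rewrite pair_big_dep.
Qed.

Theorem proposition6 (R : realType) (Sigma : finType) (f g : seq Sigma -> R)
    (hf : computed_by_afa f) (hg : computed_by_afa g)
    (alpha beta : R) (alpha_ge0 : 0 <= alpha) (beta_ge0 : 0 <= beta)
    (alphaDbeta : alpha + beta = 1) :
  exists C : afa R Sigma,
    forall w : seq Sigma, afa_fun C w = alpha * f w + beta * g w.
Proof.
case: hf hg => [A fE] [B gE].
pose S : finType := (bool * ('I_(afa_size A) * 'I_(afa_size B)))%type.
pose coef (b : bool) := if b then alpha else beta.
(* Block diagonal: the Kronecker delta keeps the two copies from mixing. *)
pose M x (s t : S) := (s.1 == t.1)%:R *
  (afa_trans A x s.2.1 t.2.1 * afa_trans B x s.2.2 t.2.2).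
pose v w (s : S) := coef s.1 * (afa_final A w s.2.1 0 * afa_final B w s.2.2 0).
(* Copy [true] constrains only the coordinate of [A], copy [false] only that of [B]; the other
   implication is vacuous. *)
pose accA b : pred 'I_(afa_size A) := fun i => b ==> (i \in afa_acc A).
pose accB b : pred 'I_(afa_size B) := fun j => ~~ b ==> (j \in afa_acc B).
have sum_tensor := sum_bool_tensor (fun=> xpredT) (fun=> xpredT).
have col_sum k (N : 'M[R]_k) : affine_mx N -> forall j, \sum_i N i j = 1.
  by move=> affN j; rewrite -[RHS](affN j); apply: eq_bigr => i _; rewrite mxE.
have M_affine x t : \sum_s M x s t = 1.
  rewrite (sum_tensor _ _ _ (fun b => (b == t.1)%:R)
    (fun _ i => afa_trans A x i t.2.1) (fun _ j => afa_trans B x j t.2.2)).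
  rewrite big_bool /= !(col_sum _ _ (afa_trans_affine _)) !mulr1.
  by case: (t.1); rewrite ?addr0 ?add0r.
have v_affine : \sum_s v [::] s = 1.
  rewrite (sum_tensor _ _ _ coef (fun _ i => afa_final A [::] i 0)
    (fun _ j => afa_final B [::] j 0)).
  by rewrite big_bool /= !afa_final_affine !mulr1.
have v_rcons w x s : v (rcons w x) s = \sum_t M x s t * v w t.
  (* Regrouping by copy, [A] and [B] gives the mixed-product rule for tensors. *)
  under eq_bigr do rewrite /M /v mulrACA [X in _ * X]mulrACA.
  rewrite (sum_tensor _ _ _ (fun b => (s.1 == b)%:R * coef b)
    (fun _ i => afa_trans A x s.2.1 i * afa_final A w i 0)
    (fun _ j => afa_trans B x s.2.2 j * afa_final B w j 0)).
  rewrite big_bool /v !afa_final_rcons !mxE.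
  by case: (s.1); rewrite /= !(mul0r, mul1r) ?addr0 ?add0r.
have [C CE] := afa_of_finType
  [set s : S | accA s.1 s.2.1 && accB s.1 s.2.2] M_affine v_affine v_rcons.
exists C => w; rewrite {}CE fE gE /afa_fun.
(* Nonnegativity of [alpha] and [beta] lets the coefficient leave the absolute value. *)
have normE s : `|v w s| =
    coef s.1 * (`|afa_final A w s.2.1 0| * `|afa_final B w s.2.2 0|).
  by rewrite !normrM ger0_norm // /coef; case: ifP.
under eq_bigr do rewrite normE.
under [X in _ / X]eq_bigr do rewrite normE.
under eq_bigl do rewrite inE.
rewrite (sum_bool_tensor accA accB coef (fun _ i => `|afa_final A w i 0|)
  (fun _ j => `|afa_final B w j 0|)).
rewrite (sum_tensor _ _ _ coef (fun _ i => `|afa_final A w i 0|)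
  (fun _ j => `|afa_final B w j 0|)).
rewrite !big_bool /= -[X in _ / X]mulrDl alphaDbeta mul1r.
(* The norm for [B] cancels in the [alpha] term, the norm for [A] in the [beta] term. *)
have := afa_norm_gt0 A w; have := afa_norm_gt0 B w.
move=> /lt0r_neq0 nzB /lt0r_neq0 nzA.
rewrite invfM mulrDl; congr (_ + _).
  by rewrite -mulrA [X in _ * X]mulrACA divff // mulr1.
by rewrite -mulrA [X in _ * X]mulrACA divff // mul1r.
Qed.
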